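(* For $u:X\to\mathbb R$ (with $u_i=u(i)$) and $l\in\mathbb Z^d$ let $$\tilde u^l=\frac1{\#[(Q_{T,d}\times Q_{T,k})\cap X]}\sum_{i\in(Q^l_{T,d}\times Q_{T,k})\cap X}u_i.$$ (i) There exists $C=C(X)>0$ such that, for every $u:X\to\mathbb R$ and every $l\in\mathbb Z^d$, $$\sum_{i\in(Q^l_{T,d}\times Q_{T,k})\cap X}|u_i-\tilde u^l|^2\le C\sum_{i,j\in(Q^l_{T,d}\times Q_{T,k})\cap X}|u_i-u_j|^2.$$ (ii) There exist positive constants $C$ and $M$ such that, for every $u:X\to\mathbb R$ and every $l\in\mathbb Z^d$, $$\sum_{i\in(Q^l_{T,d}\times Q_{T,k})\cap X}|u_i-\tilde u^l|^2\le C\sum_{i,j\in[(Q^l_{T,d}+(-M,M)^d)\times Q_{T,k}]\cap X}a_{ij}|u_i-u_j|^2.$$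
   Context: Setting. Let $d,k\ge1$ and $T\in\mathbb N$, $T\ge1$. Put $Q_{T,d}=[0,T)^d$, $Q^l_{T,d}=lT+[0,T)^d$ for $l\in\mathbb Z^d$, and $Q_{T,k}=[0,T)^k$. $X\subset\mathbb Z^d\times\{0,\dots,T-1\}^k$ is a fixed nonempty set and $\mathcal E\subset X\times X$ is a set of edges such that: (i) $X$ is $T$-periodic in $e_1,\dots,e_d$ ($X+Te_m=X$ for $m=1,\dots,d$); (ii) for all $i,j\in X$ there is a finite sequence $i_0=i,i_1,\dots,i_N=j$ in $X$ with $(i_n,i_{n+1})\in\mathcal E$ for every $n$, and $\mathcal E$ is $T$-periodic, i.e. invariant under $(i,j)\mapsto(i+Te_m,j+Te_m)$, $m=1,\dots,d$; (iii) there is $R>0$ with $|i-j|\le R$ for all $(i,j)\in\mathcal E$. The coefficients $a_{ij}$, $i,j\in X$, satisfy $a_{i+Te_m\,j+Te_m}=a_{ij}$ for $m=1,\dots,d$, $a_{ij}>0$ if $(i,j)\in\mathcal E$, and $a_{ij}=0$ if $(i,j)\notin\mathcal E$. *)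

(* Defs.v *)
From mathcomp Require Import all_boot all_order all_algebra finmap.
From mathcomp Require Import boolp classical_sets functions cardinality fsbigop.
From mathcomp Require Import reals.

Set Implicit Arguments.
Unset Strict Implicit.
Unset Printing Implicit Defensive.

Import Order.TTheory GRing.Theory Num.Theory.

Local Open Scope classical_set_scope.
Local Open Scope ring_scope.

Notation site d k := ('rV[int]_d * 'rV[int]_k)%type.

Definition slab (d k T : nat) : set (site d k) :=
  [set i : site d k | forall m : 'I_k, 0 <= i.2 0 m < T%:Z].

(* i |-> i + T e_m, where e_m is one of the first d basis vectors *)
Definition shift (d k T : nat) (m : 'I_d) (i : site d k) : site d k :=
  i + (T%:Z *: delta_mx 0 m, 0).

Definition periodic_set (d k T : nat) (X : set (site d k)) : Prop :=
  forall m : 'I_d, shift T m @` X = X.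

Definition periodic_edges (d k T : nat)
    (E : set (site d k * site d k)) : Prop :=
  forall m : 'I_d, [set (shift T m e.1, shift T m e.2) | e in E] = E.

Definition edge_connected (d k : nat) (X : set (site d k))
    (E : set (site d k * site d k)) : Prop :=
  forall i j, X i -> X j ->
    exists (N : nat) (p : nat -> site d k),
      [/\ p 0%N = i, p N = j,
          forall n, (n <= N)%N -> X (p n) &
          forall n, (n < N)%N -> E (p n, p n.+1)].

(* Euclidean norm *)
Definition site_norm (R : realType) (d k : nat) (i : site d k) : R :=
  Num.sqrt (\sum_(m < d) (i.1 0 m)%:~R ^+ 2 + \sum_(m < k) (i.2 0 m)%:~R ^+ 2).

Definition finite_range (R : realType) (d k : nat)
    (E : set (site d k * site d k)) : Prop :=
  exists2 r : R, 0 < r & forall i j, E (i, j) -> site_norm R (i - j) <= r.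

(* The coefficients are only constrained at pairs of points of X, so that a
   total function stands for a family indexed by X x X. *)
Definition admissible_coefficients (R : realType) (d k T : nat)
    (X : set (site d k)) (E : set (site d k * site d k))
    (a : site d k -> site d k -> R) : Prop :=
  forall i j, X i -> X j ->
    [/\ forall m : 'I_d, a (shift T m i) (shift T m j) = a i j,
        E (i, j) -> 0 < a i j &
        ~ E (i, j) -> a i j = 0].

Definition cube (R : realType) (T n : nat) : set 'rV[R]_n :=
  [set x | forall m : 'I_n, 0 <= x 0 m < T%:R].

(* l T + [0, T)^d *)
Definition cell (R : realType) (T d : nat) (l : 'rV[int]_d) : set 'rV[R]_d :=
  [set T%:R *: map_mx intr l + x | x in @cube R T d].

Definition open_cube (R : realType) (d : nat) (M : R) : set 'rV[R]_d :=
  [set x | forall m : 'I_d, - M < x 0 m < M].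

Definition minkowski_sum (R : realType) (d : nat) (A B : set 'rV[R]_d) :
    set 'rV[R]_d :=
  [set x + y | x in A & y in B].

(* (A x B) intersected with X, where the lattice Z^d x Z^k containing X is
   embedded in R^d x R^k. *)
Definition restrict_sites (R : realType) (d k : nat) (X : set (site d k))
    (A : set 'rV[R]_d) (B : set 'rV[R]_k) : set (site d k) :=
  [set i : site d k | A (map_mx intr i.1) /\ B (map_mx intr i.2)] `&` X.

Definition cell_sites (R : realType) (d k T : nat) (X : set (site d k))
    (l : 'rV[int]_d) : set (site d k) :=
  restrict_sites X (@cell R T d l) (@cube R T k).

Definition wide_cell_sites (R : realType) (d k T : nat) (X : set (site d k))
    (M : R) (l : 'rV[int]_d) : set (site d k) :=
  restrict_sites X (minkowski_sum (@cell R T d l) (@open_cube R d M))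
    (@cube R T k).

(* Sums `\sum_(i \in A)` over a set and `fset_set A` have junk values only for
   infinite A; all the sets of sites used here are bounded, hence finite. *)
Definition cell_average (R : realType) (d k T : nat) (X : set (site d k))
    (u : site d k -> R) (l : 'rV[int]_d) : R :=
  (#|` fset_set (restrict_sites X (@cube R T d) (@cube R T k))|%fset)%:R^-1
  * \sum_(i \in cell_sites R T X l) u i.

(* Main.v *)
Require Import Defs.
From mathcomp Require Import all_boot all_order all_algebra finmap.
From mathcomp Require Import boolp classical_sets functions cardinality fsbigop.
From mathcomp Require Import reals.
From mathcomp Require Import zify ring lra.

Set Implicit Arguments.
Unset Strict Implicit.
Unset Printing Implicit Defensive.

Import Order.TTheory GRing.Theory Num.Theory.

Local Open Scope classical_set_scope.
Local Open Scope ring_scope.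

(** The squared distance from [u i] to an average is at most the average of the
    squared distances [`|u i - u j| ^+ 2]; this convexity inequality
    ([sqr_dist_mean_le]) gives the first bound, with constant 1.

    For the second bound it then suffices to control [`|u i - u j| ^+ 2] for
    [i], [j] in one cell by the weighted energy of a larger window.  If [(i, j)]
    is an edge, this quantity is [(a i j)^-1] times a single term of the energy,
    and a path of edges is handled by iterating
    [(x + y) ^+ 2 <= 2 * x ^+ 2 + 2 * y ^+ 2].  A path may leave the cell, but
    it has finitely many vertices, so it lies in every large enough window.
    One constant and one window size serve all pairs because a cell holds
    finitely many sites; they serve all cells because the translation by [T l]
    maps cell 0 onto cell [l] and preserves [X] and the coefficients.

    The bookkeeping of constants is carried by the predicate [dominated]: the
    functionals of [u] that are bounded by some [B] times the energy of every
    window of size at least [B] around cell 0.  They are stable under addition,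
    hence under finite sums ([dominated_fsum]); they contain the squared
    increments along edges ([dominated_edge]), then along paths
    ([dominated_path]), then the total oscillation over the cell. *)

(** * Finite sums and the Poincare inequality for the mean *)

Section FiniteSums.
Variable R : realType.

(** With [m] the mean and [n] the number of terms, the right-hand side equals
    [n * (x - m) ^+ 2] plus the variance term [\sum_j (m - u j) ^+ 2], and
    [n >= 1]. *)
Lemma sqr_dist_mean_le (I : Type) (s : seq I) (u : I -> R) (x : R) :
  (0 < size s)%N ->
  `|x - (size s)%:R^-1 * \sum_(j <- s) u j| ^+ 2
    <= \sum_(j <- s) `|x - u j| ^+ 2.
Proof.
move=> s_gt0; set n : R := (size s)%:R; set S := \sum_(j <- s) u j.
have n_ge1 : 1 <= n by rewrite /n ler1n.
have n_neq0 : n != 0 by rewrite gt_eqF // (lt_le_trans ltr01).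
set m := n^-1 * S.
have Sm : S = n * m by rewrite /m mulrA divff // mul1r.
have -> : \sum_(j <- s) `|x - u j| ^+ 2
    = n * (x - m) ^+ 2 + \sum_(j <- s) (m - u j) ^+ 2.
  have -> : \sum_(j <- s) `|x - u j| ^+ 2
      = \sum_(j <- s) ((x ^+ 2 - m ^+ 2) + (2 * (m - x)) * u j
                       + (m - u j) ^+ 2).
    by apply: eq_bigr => j _; rewrite real_normK ?num_real//; ring.
  set c := x ^+ 2 - m ^+ 2; rewrite 2!big_split /=.
  rewrite -(mulr_sumr _ _ _ (2 * (m - x))) -/S Sm big_const_seq.
  rewrite count_predT iter_addr addr0 -mulr_natl -/n /c; ring.
rewrite real_normK ?num_real// -[leLHS]addr0 lerD//.
  by rewrite ler_peMl// sqr_ge0.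
by apply: sumr_ge0 => j _; rewrite sqr_ge0.
Qed.

Lemma fsumr_ge0 (I : choiceType) (A : set I) (F : I -> R) :
  finite_set A -> (forall i, A i -> 0 <= F i) -> 0 <= \sum_(i \in A) F i.
Proof.
move=> fA F0; rewrite fsbig_finite//= big_seq; apply: sumr_ge0 => i.
by rewrite in_fset_set// inE; exact: F0.
Qed.

Lemma ler_fsum (I : choiceType) (A : set I) (F G : I -> R) :
  finite_set A -> (forall i, A i -> F i <= G i) ->
  \sum_(i \in A) F i <= \sum_(i \in A) G i.
Proof.
move=> fA FG; rewrite !fsbig_finite//= big_seq [leRHS]big_seq.
by apply: ler_sum => i; rewrite in_fset_set// inE; exact: FG.
Qed.

Lemma ler_fsum_term (I : choiceType) (A : set I) (F : I -> R) (i : I) :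
  finite_set A -> (forall j, A j -> 0 <= F j) -> A i ->
  F i <= \sum_(j \in A) F j.
Proof.
move=> fA F0 Ai; rewrite (fsbigD1 i)//= lerDl.
by apply: fsumr_ge0 => [|j [/F0]//]; apply: sub_finite_set fA => j [].
Qed.

Lemma poincare_mean (I : choiceType) (A : set I) (u : I -> R) :
  finite_set A ->
  \sum_(i \in A) `|u i - (#|` fset_set A|%fset)%:R^-1
                         * \sum_(j \in A) u j| ^+ 2
    <= \sum_(i \in A) \sum_(j \in A) `|u i - u j| ^+ 2.
Proof.
move=> fA; apply: ler_fsum => // i Ai.
rewrite !(fsbig_finite _ _ fA)/=; apply: sqr_dist_mean_le.
by rewrite -has_predT; apply/hasP; exists i; rewrite // in_fset_set// inE.
Qed.

End FiniteSums.

(** * Bounded sets of lattice sites are finite *)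

Section Finiteness.

Lemma finite_int_box (n B : nat) :
  finite_set [set x : 'rV[int]_n | forall m, `|x 0 m| <= B%:Z].
Proof.
apply: (@sub_finite_set _ _
  [set map_mx (fun j : 'I_(B + B).+1 => j%:Z - B%:Z) y
     | y in [set: 'rV['I_(B + B).+1]_n]]); last exact: finite_image.
move=> x xB; exists (\row_m inord (absz (x 0 m + B%:Z))) => //.
apply/rowP => m; rewrite !mxE; have := xB m; rewrite ler_norml => /andP[x1 x2].
move: (x 0 m) x1 x2 => z x1 x2; rewrite inordK; lia.
Qed.

Lemma finite_restrict_sites (R : realType) (d k : nat) (X : set (site d k))
    (A : set 'rV[R]_d) (B : set 'rV[R]_k) (r : R) :
  (forall x m, A x -> `|x 0 m| <= r) -> (forall x m, B x -> `|x 0 m| <= r) ->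
  finite_set (restrict_sites X A B).
Proof.
move=> Ar Br.
have bound n (y : 'rV[int]_n) :
    (forall m, `|(map_mx intr y : 'rV[R]_n) 0 m| <= r) ->
    forall m, `|y 0 m| <= (Num.bound `|r|)%:Z.
  move=> yr m; rewrite -(ler_int R) intr_norm.
  have := yr m; rewrite mxE => h; apply: (le_trans h).
  by rewrite (le_trans (ler_norm r))// -pmulrn ltW// archi_boundP.
apply: sub_finite_set (finite_setX (finite_int_box d (Num.bound `|r|))
  (finite_int_box k (Num.bound `|r|))).
by move=> [i1 i2] [[/= Ai Bi] _]; split; apply: bound => m; auto.
Qed.

End Finiteness.

(** * Invariance under the translations by T l *)

Section Translation.
Variables (d k T : nat).

(** Periodicity is only assumed along the basis vectors.  As the step is an
    equivalence, it can be run backwards, which reaches vectors with negative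
    coordinates. *)
Lemma lattice_ind (P : 'rV[int]_d -> Prop) :
  P 0 -> (forall m l, P l <-> P (l + delta_mx 0 m)) -> forall l, P l.
Proof.
move=> P0 Pstep l.
have line z m l' : P l' -> P (l' + z *: delta_mx 0 m).
  elim: z => [|n IH|n IH] Pl'; first by rewrite scale0r addr0.
    rewrite intS scalerDl scale1r addrCA addrC.
    by apply/(iffLR (Pstep m _)); exact: IH.
  apply/(iffRL (Pstep m _)).
  by rewrite intS opprD scalerDl scaleN1r addrCA addrAC addNr add0r; exact: IH.
rewrite [l]row_sum_delta; elim/big_rec: _ => [//|m y _ Py].
by rewrite addrC; exact: line.
Qed.

Definition translate (l : 'rV[int]_d) (i : site d k) : site d k :=
  i + (T%:Z *: l, 0).

Lemma translate0 i : translate 0 i = i.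
Proof. by rewrite /translate scaler0 addr0. Qed.

Lemma translateD l1 l2 i :
  translate (l1 + l2) i = translate l2 (translate l1 i).
Proof.
by rewrite /translate -addrA; congr (_ + _); apply/eqP; rewrite xpair_eqE /=;
  rewrite scalerDr addr0 !eqxx.
Qed.

Lemma translateK l : cancel (translate l) (translate (- l)).
Proof. by move=> i; rewrite -translateD subrr translate0. Qed.

Lemma translateNK l : cancel (translate (- l)) (translate l).
Proof. by move=> i; rewrite -translateD addNr translate0. Qed.

Lemma shift_inj (m : 'I_d) : injective (@shift d k T m).
Proof. exact: (can_inj (translateK (delta_mx 0 m))). Qed.

Variable X : set (site d k).
Hypothesis X_periodic : periodic_set T X.

Lemma periodic_shift m i : X (shift T m i) <-> X i.
Proof.
split=> [|Xi]; rewrite -{1}(X_periodic m); last by exists i.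
by move=> [j Xj /shift_inj <-].
Qed.

Lemma periodic_translate l i : X (translate l i) <-> X i.
Proof.
elim/lattice_ind: l => [|m l]; first by rewrite translate0.
by rewrite translateD periodic_shift.
Qed.

Lemma coefficient_translate (R : realType) (E : set (site d k * site d k))
    (a : site d k -> site d k -> R) l i j :
  admissible_coefficients T X E a -> X i -> X j ->
  a (translate l i) (translate l j) = a i j.
Proof.
move=> Ha Xi Xj; elim/lattice_ind: l => [|m l]; first by rewrite !translate0.
rewrite !translateD.
have [-> _ _] := Ha _ _ (iffRL (periodic_translate l i) Xi)
                        (iffRL (periodic_translate l j) Xj).
by [].
Qed.

Variable R : realType.

Lemma restrict_sites_translate (A : set 'rV[R]_d) (B : set 'rV[R]_k) l :
  restrict_sites X [set T%:R *: map_mx intr l + x | x in A] B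
    = translate l @` restrict_sites X A B.
Proof.
have emb i : map_mx intr (translate l i).1
    = T%:R *: map_mx intr l + map_mx intr i.1 :> 'rV[R]_d.
  by apply/rowP => m; rewrite !mxE rmorphD rmorphM /= addrC.
apply/seteqP; split=> [i [[[x Ax xi] Bi] Xi]|_ [i [[Ai Bi] Xi] <-]].
  exists (translate (- l) i); last by rewrite translateNK.
  split; last by apply/periodic_translate.
  split; last by rewrite /= addr0.
  suff -> : map_mx intr (translate (- l) i).1 = x :> 'rV[R]_d by [].
  apply: (@addrI _ (T%:R *: map_mx intr l)).
  by rewrite -emb translateNK xi.
split; last by apply/periodic_translate.
split; last by rewrite /= addr0.
by rewrite /= emb; exists (map_mx intr i.1).
Qed.

Lemma cell0 : @cell R T d 0 = @cube R T d.
Proof.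
have h x : T%:R *: map_mx intr (0 : 'rV[int]_d) + x = x :> 'rV[R]_d.
  by rewrite map_mx0 scaler0 add0r.
apply/seteqP; split=> [_ [x xC <-]|x xC]; first by rewrite h.
by exists x.
Qed.

Lemma cell_sitesE l :
  cell_sites R T X l = translate l @` cell_sites R T X 0.
Proof.
by rewrite /cell_sites cell0 -restrict_sites_translate.
Qed.

Lemma wide_cell_sitesE (M : R) l :
  wide_cell_sites T X M l = translate l @` wide_cell_sites T X M 0.
Proof.
rewrite /wide_cell_sites -restrict_sites_translate; congr restrict_sites.
rewrite cell0; apply/seteqP; split.
  move=> _ [_ [x xC <-]] [y yM] <-; exists (x + y); last by rewrite addrA.
  by exists x => //; exists y.
move=> _ [_ [x xC [y yM <-]] <-]; exists (T%:R *: map_mx intr l + x).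
  by exists x.
by exists y => //; rewrite addrA.
Qed.

Lemma fsum_translate (A : set (site d k)) l (F : site d k -> R) :
  \sum_(i \in translate l @` A) F i = \sum_(i \in A) F (translate l i).
Proof.
apply: reindex_fsbig; split=> [i Ai||]; first by exists i.
  by move=> i j _ _ /(can_inj (translateK l)).
by [].
Qed.

Lemma cell_average_translate (u : site d k -> R) l :
  cell_average T X u l = cell_average T X (u \o translate l) 0.
Proof. by rewrite /cell_average cell_sitesE fsum_translate. Qed.

Lemma finite_cell_sites l : finite_set (cell_sites R T X l).
Proof.
rewrite cell_sitesE; apply: finite_image; rewrite /cell_sites cell0.
by apply: (@finite_restrict_sites _ _ _ _ _ _ T%:R) => x m /(_ m)/andP[x0 xT];
  rewrite ger0_norm// ltW.
Qed.

Lemma finite_wide_cell_sites (M : R) l :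
  finite_set (wide_cell_sites T X M l).
Proof.
rewrite wide_cell_sitesE; apply: finite_image.
rewrite /wide_cell_sites cell0.
apply: (@finite_restrict_sites _ _ _ _ _ _ (T%:R + `|M|)) => x m.
  move=> [y /(_ m)/andP[y0 yT]] [z /(_ m)/andP[z1 z2]] <-; rewrite mxE.
  apply: (le_trans (ler_normD _ _)); apply: lerD.
    by rewrite ger0_norm// ltW.
  by rewrite (le_trans _ (ler_norm M))// ler_norml !ltW.
move=> /(_ m)/andP[x0 xT]; rewrite ger0_norm//.
by rewrite (le_trans (ltW xT))// lerDl.
Qed.

End Translation.

(** * Quantities controlled by the energy of a large window *)

Section Domination.
Variables (R : realType) (d k T : nat).
Hypothesis T_gt0 : (0 < T)%N.
Variable X : set (site d k).
Hypothesis X_slab : X `<=` @slab d k T.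
Variables (E : set (site d k * site d k)) (a : site d k -> site d k -> R).
Hypothesis X_periodic : periodic_set T X.
Hypothesis a_admissible : admissible_coefficients T X E a.

Definition local_energy (M : R) (l : 'rV[int]_d) (u : site d k -> R) : R :=
  \sum_(i \in wide_cell_sites T X M l) \sum_(j \in wide_cell_sites T X M l)
     a i j * `|u i - u j| ^+ 2.

Let coefficient_ge0 i j : X i -> X j -> 0 <= a i j.
Proof.
move=> Xi Xj; have [_ apos azero] := a_admissible Xi Xj.
by have [/apos/ltW//|/azero->] := pselect (E (i, j)).
Qed.

Let term_ge0 (M : R) l (u : site d k -> R) i j :
  wide_cell_sites T X M l i -> wide_cell_sites T X M l j ->
  0 <= a i j * `|u i - u j| ^+ 2.
Proof.
by move=> [_ Xi] [_ Xj]; rewrite mulr_ge0 ?coefficient_ge0// exprn_ge0.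
Qed.

Lemma local_energy_ge0 M l u : 0 <= local_energy M l u.
Proof.
have fW := finite_wide_cell_sites X_periodic M l.
apply: fsumr_ge0 => // i Wi; apply: fsumr_ge0 => // j Wj.
exact: term_ge0 Wi Wj.
Qed.

Lemma term_le_local_energy M l u i j :
  wide_cell_sites T X M l i -> wide_cell_sites T X M l j ->
  a i j * `|u i - u j| ^+ 2 <= local_energy M l u.
Proof.
move=> Wi Wj; have fW := finite_wide_cell_sites X_periodic M l.
apply: (@le_trans _ _
  (\sum_(j \in wide_cell_sites T X M l) a i j * `|u i - u j| ^+ 2)).
  apply: (ler_fsum_term (F := fun j => a i j * `|u i - u j| ^+ 2)) => //.
  by move=> j' Wj'; exact: term_ge0 Wi Wj'.
apply: (ler_fsum_term (F := fun i =>
  \sum_(j \in wide_cell_sites T X M l) a i j * `|u i - u j| ^+ 2)) => //.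
by move=> i' Wi'; apply: fsumr_ge0 => // j' Wj'; exact: term_ge0 Wi' Wj'.
Qed.

Lemma local_energy_translate M l u :
  local_energy M l u = local_energy M 0 (u \o translate T l).
Proof.
rewrite /local_energy wide_cell_sitesE// fsum_translate.
apply: eq_fsbigr => i /set_mem[_ Xi]; rewrite fsum_translate.
apply: eq_fsbigr => j /set_mem[_ Xj].
by rewrite (coefficient_translate _ _ a_admissible).
Qed.

(** The origin belongs to cell 0, so a window contains [i] once [M] exceeds
    the first [d] coordinates of [i] in absolute value; the remaining [k]
    coordinates are in range because [X] lies in the slab. *)
Lemma wide_cell_sites_exhaust i :
  X i -> exists B : R, forall M, B <= M -> wide_cell_sites T X M 0 i.
Proof.
move=> Xi; exists (1 + \sum_m `|i.1 0 m|%:~R) => M BM; split=> //; split.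
  exists 0.
    by rewrite cell0 => m; rewrite mxE lexx ltr0n.
  exists (map_mx intr i.1); last by rewrite add0r.
  move=> m; rewrite -ltr_norml mxE -intr_norm; apply: lt_le_trans BM.
  by rewrite (bigD1 m)//= addrCA ltrDl ltr_wpDr// sumr_ge0.
by move=> m; rewrite mxE ler0z [T%:R]pmulrn ltr_int; exact: (X_slab Xi).
Qed.

(** The same [B] serves as multiplicative constant and as threshold for the
    window size [M], so that adding two such bounds only requires adding their
    constants. *)
Definition dominated (F : (site d k -> R) -> R) : Prop :=
  exists2 B : R, 0 < B &
    forall M u, B <= M -> F u <= B * local_energy M 0 u.

Lemma dominated_le F G :
  (forall u, F u <= G u) -> dominated G -> dominated F.
Proof.
move=> FG [B B0 GB]; exists B => // M u BM.
exact: le_trans (FG u) (GB M u BM).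
Qed.

Lemma dominated0 : dominated (fun=> 0).
Proof.
by exists 1 => // M u _; rewrite mul1r local_energy_ge0.
Qed.

Lemma dominatedD F G :
  dominated F -> dominated G -> dominated (fun u => F u + G u).
Proof.
move=> [B B0 FB] [B' B'0 GB]; exists (B + B'); first exact: addr_gt0.
move=> M u BM; rewrite mulrDl lerD//.
  by apply: FB; apply: le_trans BM; rewrite lerDl ltW.
by apply: GB; apply: le_trans BM; rewrite lerDr ltW.
Qed.

Lemma dominated_fsum (I : choiceType) (A : set I) F :
  finite_set A -> (forall i, A i -> dominated (F i)) ->
  dominated (fun u => \sum_(i \in A) F i u).
Proof.
move=> fA FA.
have -> : (fun u => \sum_(i \in A) F i u)
    = (fun u => \sum_(i <- fset_set A) F i u).
  by apply: funext => u; rewrite fsbig_finite.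
have : forall i, i \in (fset_set A : seq I) -> dominated (F i).
  by move=> i; rewrite in_fset_set// inE; exact: FA.
elim: (fset_set A : seq I) => [_|i s IH sF].
  by apply: dominated_le dominated0 => u; rewrite big_nil.
apply: (@dominated_le _ (fun u => F i u + \sum_(j <- s) F j u)).
  by move=> u; rewrite big_cons.
apply: dominatedD; first by apply: sF; rewrite mem_head.
by apply: IH => j js; apply: sF; rewrite in_cons js orbT.
Qed.

(** The constant must exceed [(a i j)^-1], to compare with one term of the
    energy, and also the window sizes from which [i] and [j] are both present. *)
Lemma dominated_edge i j :
  X i -> X j -> E (i, j) -> dominated (fun u => `|u i - u j| ^+ 2).
Proof.
move=> Xi Xj Eij; have [_ /(_ Eij) aij _] := a_admissible Xi Xj.
have [Bi Wi] := wide_cell_sites_exhaust Xi.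
have [Bj Wj] := wide_cell_sites_exhaust Xj.
exists (`|Bi| + `|Bj| + (a i j)^-1).
  by rewrite ltr_wpDl ?invr_gt0// addr_ge0.
move=> M u BM.
have BiM : Bi <= M.
  by have := ler_norm Bi; have := normr_ge0 Bj; have := invr_gt0 (a i j); lra.
have BjM : Bj <= M.
  by have := ler_norm Bj; have := normr_ge0 Bi; have := invr_gt0 (a i j); lra.
apply: (@le_trans _ _ ((a i j)^-1 * local_energy M 0 u)).
  rewrite -(ler_pM2l aij) mulVKf ?gt_eqF//.
  by apply: term_le_local_energy; [exact: Wi|exact: Wj].
by rewrite ler_wpM2r ?local_energy_ge0// lerDr addr_ge0.
Qed.

Lemma dominated_path (p : nat -> site d k) N :
  (forall n, (n <= N)%N -> X (p n)) ->
  (forall n, (n < N)%N -> E (p n, p n.+1)) ->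
  dominated (fun u => `|u (p 0%N) - u (p N)| ^+ 2).
Proof.
elim: N => [|N IH] Xp Ep.
  by apply: dominated_le dominated0 => u; rewrite subrr normr0 expr0n.
have dN : dominated (fun u => `|u (p 0%N) - u (p N)| ^+ 2).
  by apply: IH => n nN; [apply: Xp|apply: Ep]; rewrite ltnW.
have dE : dominated (fun u => `|u (p N) - u (p N.+1)| ^+ 2).
  by apply: dominated_edge; [exact: Xp|exact: Xp|exact: Ep].
apply: dominated_le (dominatedD (dominatedD dN dN) (dominatedD dE dE)) => u /=.
rewrite !real_normK ?num_real//.
set x := u (p 0%N); set y := u (p N); set z := u (p N.+1).
(* By the parallelogram identity, twice the sum of the squares of x - y and
   y - z exceeds (x - z) ^+ 2 by this square. *)
have := sqr_ge0 ((x - y) - (y - z)); nra.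
Qed.

(** The paths joining two sites depend on the pair only, and a cell contains
    finitely many pairs: this is where the constants become uniform. *)
Lemma cell_oscillation_dominated : edge_connected X E ->
  dominated (fun u => \sum_(i \in cell_sites R T X 0)
    \sum_(j \in cell_sites R T X 0) `|u i - u j| ^+ 2).
Proof.
move=> EC; have fS := finite_cell_sites X_periodic R 0.
apply: dominated_fsum => // i [_ Xi]; apply: dominated_fsum => // j [_ Xj].
by have [N [p [<- <- Xp Ep]]] := EC i j Xi Xj; exact: dominated_path.
Qed.

End Domination.

(** * The two inequalities *)

(** The average over cell [l] is normalised by the number of sites of cell 0, so
    everything is moved to cell 0, where it is the true mean. *)
Lemma poincare_cell (R : realType) (d k T : nat) (X : set (site d k))
    (X_periodic : periodic_set T X) (u : site d k -> R) (l : 'rV[int]_d) :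
  \sum_(i \in cell_sites R T X l) `|u i - cell_average T X u l| ^+ 2
    <= \sum_(i \in cell_sites R T X l) \sum_(j \in cell_sites R T X l)
         `|u i - u j| ^+ 2.
Proof.
have avg (v : site d k -> R) : cell_average T X v 0
    = (#|` fset_set (cell_sites R T X 0)|%fset)%:R^-1
      * \sum_(i \in cell_sites R T X 0) v i.
  by rewrite /cell_average /cell_sites cell0.
rewrite cell_average_translate// avg cell_sitesE// !fsum_translate.
under [leRHS]eq_fsbigr do rewrite fsum_translate.
exact: (poincare_mean (u \o translate T l) (finite_cell_sites X_periodic R 0)).
Qed.

Theorem proposition3p3 (R : realType) (d k T : nat)
    (d_ge1 : (1 <= d)%N) (k_ge1 : (1 <= k)%N) (T_ge1 : (1 <= T)%N)
    (X : set (site d k)) (X_nonempty : X !=set0) (X_slab : X `<=` @slab d k T)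
    (X_periodic : periodic_set T X) :
  (exists2 C : R, 0 < C &
    forall (u : site d k -> R) (l : 'rV[int]_d),
      \sum_(i \in cell_sites R T X l) `|u i - cell_average T X u l| ^+ 2
      <= C * \sum_(i \in cell_sites R T X l) \sum_(j \in cell_sites R T X l)
               `|u i - u j| ^+ 2)
  /\
  (forall (E : set (site d k * site d k)) (a : site d k -> site d k -> R),
    E `<=` X `*` X ->
    edge_connected X E ->
    periodic_edges T E ->
    finite_range R E ->
    admissible_coefficients T X E a ->
    exists C M : R, [/\ 0 < C, 0 < M &
      forall (u : site d k -> R) (l : 'rV[int]_d),
        \sum_(i \in cell_sites R T X l) `|u i - cell_average T X u l| ^+ 2
        <= C * \sum_(i \in wide_cell_sites T X M l)
                 \sum_(j \in wide_cell_sites T X M l)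
                   a i j * `|u i - u j| ^+ 2]).
Proof.
split=> [|E a _ E_connected _ _ a_admissible].
  by exists 1 => // u l; rewrite mul1r; exact: poincare_cell.
have [B B_gt0 domB] :=
  cell_oscillation_dominated T_ge1 X_slab X_periodic a_admissible E_connected.
exists B, B; split=> // u l; apply: (le_trans (poincare_cell X_periodic u l)).
rewrite -[X in _ <= _ * X]/(local_energy T X a B l u).
rewrite (local_energy_translate X_periodic a_admissible).
apply: le_trans (domB B (u \o translate T l) (lexx B)).
rewrite cell_sitesE// fsum_translate.
by under eq_fsbigr do rewrite fsum_translate.
Qed.
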